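(* Let $D$ be an integrally closed domain with quotient field $K$, let $\overline{K}$ be an algebraic closure of $K$, let $f\in K[X]$ and let $n$ be a positive integer. Then $f\in \mathrm{Int}(M_n(D))$ if and only if for every integer $k$ with $0\leq k<n$, for every monic polynomial $p\in D[X]$ of degree $n$ and for every multi-set $\{\alpha_1,\ldots,\alpha_{k+1}\}$ of $k+1$ elements of the multi-set of roots of $p(X)$ in $\overline{K}$, the element $\Phi^k(f)(\alpha_1,\ldots,\alpha_{k+1})$ is integral over $D$. Moreover, if the intersection of the maximal ideals of $D$ of finite index is $(0)$, then it is sufficient to consider irreducible polynomials $p$: that is, $f\in \mathrm{Int}(M_n(D))$ if and only if for every $0\leq k<n$, for every monic polynomial $p\in D[X]$ of degree $n$ which is irreducible in $D[X]$ and for every multi-set $\{\alpha_1,\ldots,\alpha_{k+1}\}$ of $k+1$ elements of the multi-set of roots of $p(X)$ in $\overline{K}$, the element $\Phi^k(f)(\alpha_1,\ldots,\alpha_{k+1})$ is integral over $D$.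
   Context: For a domain $D$ with quotient field $K$, $M_n(D)$ is the $D$-algebra of $n\times n$ matrices with entries in $D$, and $\mathrm{Int}(M_n(D))=\{f\in K[X] : f(M)\in M_n(D)\text{ for all } M\in M_n(D)\}$ (here $f(M)$ is computed in $M_n(K)$). A maximal ideal $\mathfrak m$ of $D$ has finite index if $D/\mathfrak m$ is finite (an empty intersection of ideals is $D$). The multi-set of roots of $p$ in $\overline K$ is the collection of roots of $p$ in $\overline K$, each repeated according to its multiplicity in $p$; a multi-set of $k+1$ elements of the roots means a sub-multi-set of cardinality $k+1$ (i.e. writing the roots with multiplicity as $\beta_1,\dots,\beta_n$, it is $\{\beta_{i_0},\dots,\beta_{i_k}\}$ with $i_0,\dots,i_k$ distinct indices). Divided differences: for a polynomial $g$ over a commutative ring $R$, the $k$-th divided difference $\Phi^k(g)\in R[X_0,\ldots,X_k]$ is defined recursively by $\Phi^0(g)(X_0)=g(X_0)$, and for $k\ge 1$ $$\Phi^{k}(g)(X_0,\ldots,X_k)=\frac{\Phi^{k-1}(g)(X_0,\ldots,X_{k-2},X_{k-1})-\Phi^{k-1}(g)(X_0,\ldots,X_{k-2},X_k)}{X_{k-1}-X_{k}}.$$ It is a symmetric polynomial in $k+1$ variables with coefficients in $R$, so it can be evaluated at arbitrary, possibly repeated, elements. *)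

(* Defs.v *)
From HB Require Import structures.
From mathcomp Require Import all_boot all_algebra.
From mathcomp.multinomials Require Import mpoly.

Set Implicit Arguments.
Unset Strict Implicit.
Unset Printing Implicit Defensive.

Import GRing.Theory.
Local Open Scope ring_scope.

Section DividedDifferences.

Variable R : comNzRingType.

(* P(X_0, .., ^X_v, .., X_(k+1)), with the variable X_v left out: it is
   P(X_0, .., X_(k-1), X_k) for v = k + 1
   and P(X_0, .., X_(k-1), X_(k+1)) for v = k. *)
Definition omit_var (k : nat) (v : 'I_k.+2) (P : {mpoly R[k.+1]}) :
    {mpoly R[k.+2]} :=
  P \mPo [tuple 'X_(lift v i) | i < k.+1].

Definition penult_ord (k : nat) : 'I_k.+2 := widen_ord (leqnSn k.+1) ord_max.

Definition divdiff_step (k : nat) (P : {mpoly R[k.+1]}) :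
    pred {mpoly R[k.+2]} :=
  fun Q => Q * ('X_(penult_ord k) - 'X_ord_max)
             == omit_var ord_max P - omit_var (penult_ord k) P.

Lemma omit_varX k v (i : 'I_k.+1) : omit_var v 'X_i = 'X_(lift v i).
Proof. by rewrite /omit_var comp_mpolyXU -tnth_nth tnth_mktuple. Qed.

Lemma divdiff_step_exists k (P : {mpoly R[k.+1]}) : exists Q, divdiff_step P Q.
Proof.
pose E (P : {mpoly R[k.+1]}) := exists Q, divdiff_step P Q.
have E0 c : E c%:MP.
  exists 0; rewrite /divdiff_step /omit_var !comp_mpolyC.
  by rewrite subrr mul0r.
have E1 : E 1 by rewrite -mpolyC1; apply: E0.
have EM P1 P2 : E P1 -> E P2 -> E (P1 * P2).
  move=> [Q1 /eqP e1] [Q2 /eqP e2].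
  exists (Q1 * omit_var ord_max P2 + omit_var (penult_ord k) P1 * Q2).
  apply/eqP; rewrite mulrDl -(mulrA (omit_var _ P1)) e2 mulrAC e1.
  rewrite mulrBl mulrBr /omit_var !rmorphM /=.
  by rewrite addrA subrK.
have EX (i : 'I_k.+1) : E 'X_i.
  rewrite /E /divdiff_step !omit_varX.
  have [lt_ik|le_ki] := ltnP i k.
    exists 0; rewrite mul0r eq_sym subr_eq0; apply/eqP.
    suff -> : lift ord_max i = lift (penult_ord k) i by [].
    apply/val_inj => /=.
    by rewrite /bump [(k <= i)%N]leqNgt lt_ik ltnNge (ltnW lt_ik).
  exists 1; rewrite mul1r; have ik : i = k :> nat.
    by apply/eqP; rewrite eqn_leq le_ki -ltnS ltn_ord.
  have -> : lift ord_max i = penult_ord k.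
    by apply/val_inj; rewrite /= /bump ik ltnn.
  suff -> : lift (penult_ord k) i = ord_max by [].
  by apply/val_inj; rewrite /= /bump ik leqnn.
have EXn (i : 'I_k.+1) d : E ('X_i ^+ d).
  elim: d => [|d IHd]; first by rewrite expr0; exact: E1.
  by rewrite exprS; exact: (EM _ _ (EX i) IHd).
elim/mpolyind: P => [|c m P _ _ [Q /eqP eQ]].
  by rewrite -mpolyC0; apply: E0.
have [Q1 /eqP e1] : E (c *: 'X_[m]).
  rewrite -mul_mpolyC; apply: (EM); first exact: E0.
  rewrite mpolyXE_id; apply: (@big_ind _ E) => [|P1 P2 EP1 EP2|i _].
  - exact: E1.
  - exact: (EM _ _ EP1 EP2).
  - exact: EXn.
exists (Q1 + Q); apply/eqP; rewrite mulrDl e1 eQ /omit_var !comp_mpolyD.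
by rewrite opprD addrACA.
Qed.

(* The quotient is unique because X_k - X_(k+1) is not a zero divisor, so the
   choice made by xchoose below is immaterial. *)
Lemma mpolyX_diff_regular n (a b : 'I_n) (Q : {mpoly R[n]}) :
  a != b -> Q * ('X_a - 'X_b) = 0 -> Q = 0.
Proof.
move=> neq_ab /eqP; rewrite mulrBr subr_eq0 => /eqP eQ.
apply/mpolyP=> m; rewrite mcoeff0.
have [d] := ubnP (m b); elim: d m => // d IHd m le_mb.
rewrite -(mcoeffMX Q U_(a)) eQ.
have [m0|m0] := eqVneq (m b) 0%N.
  apply/eqP; rewrite mcoeff_eq0; apply/negP => /msuppM_le.
  case/allpairsP=> -[u v] /= [_]; rewrite msuppX inE => /eqP -> /mnmP/(_ b).
  by rewrite !mnmDE !mnm1E m0 eqxx (negPf neq_ab) addn1.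
have ub : (U_(b) <= m)%MM by rewrite lep1mP.
have -> : (U_(a) + m = U_(b) + (U_(a) + (m - U_(b))))%MM.
  by rewrite addmA [(U_(b) + _)%MM]addmC -addmA [(U_(b) + _)%MM]addmC submK.
rewrite mcoeffMX IHd // mnmDE mnmBE !mnm1E eqxx (negPf neq_ab) add0n subn1.
by rewrite -ltnS prednK ?lt0n.
Qed.

Lemma divdiff_step_unique k (P : {mpoly R[k.+1]}) Q1 Q2 :
  divdiff_step P Q1 -> divdiff_step P Q2 -> Q1 = Q2.
Proof.
move=> /eqP e1 /eqP e2; apply/eqP; rewrite -subr_eq0; apply/eqP.
apply: (@mpolyX_diff_regular _ (penult_ord k) ord_max); last first.
  by rewrite mulrBl e1 e2 subrr.
by rewrite -val_eqE /= neq_ltn ltnSn.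
Qed.

Fixpoint divdiff (g : {poly R}) (k : nat) : {mpoly R[k.+1]} :=
  if k is k'.+1 then xchoose (divdiff_step_exists (divdiff g k'))
  else (map_poly (@mpolyC 1 R) g).['X_ord0].

Lemma divdiff0 (g : {poly R}) :
  divdiff g 0 = (map_poly (@mpolyC 1 R) g).['X_ord0].
Proof. by []. Qed.

Lemma divdiffS (g : {poly R}) k :
  divdiff g k.+1 * ('X_(penult_ord k) - 'X_ord_max)
    = omit_var ord_max (divdiff g k) - omit_var (penult_ord k) (divdiff g k).
Proof. exact/eqP/(xchooseP (divdiff_step_exists (divdiff g k))). Qed.

End DividedDifferences.

Definition integrally_closed (D : idomainType) : Prop :=
  forall x : {fraction D}, integralOver (@tofrac D) x -> exists d, x = tofrac d.

Definition algebraic_closure (K : fieldType) (L : closedFieldType)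
    (iota : {rmorphism K -> L}) : Prop :=
  forall x : L, algebraicOver iota x.

(* Int(M_m(D)) for m = n + 1 >= 1. *)
Definition int_valued_mx (D : idomainType) (n : nat)
    (f : {poly {fraction D}}) : Prop :=
  forall M : 'M[D]_n.+1, exists N : 'M[D]_n.+1,
    horner_mx (map_mx (@tofrac D) M) f = map_mx (@tofrac D) N.

(* irreducible_poly is not suitable over a domain: its divisibility is
   pseudo-divisibility, i.e. divisibility over the fraction field. *)
Definition irreducible_elt (R : idomainType) (x : R) : Prop :=
  [/\ x != 0, x \isn't a GRing.unit
    & forall y z, x = y * z -> y \is a GRing.unit \/ z \is a GRing.unit].

(* An idealr is a proper ideal. *)
Definition maximal_ideal (R : comNzRingType) (m : idealr R) : Prop :=
  forall J : idealr R, {subset m <= J} -> {subset J <= m}.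

Definition finite_index (R : comNzRingType) (m : idealr R) : Prop :=
  exists s : seq {ideal_quot m}, forall x, x \in s.

Definition roots_with_mult (L : fieldType) (q : {poly L}) (rs : seq L) : Prop :=
  q = lead_coef q *: \prod_(b <- rs) ('X - b%:P).

(* Phi^k(f)(alpha_1, .., alpha_(k+1)) is integral over D for every sub-multi-set
   {alpha_1, .., alpha_(k+1)} of the multi-set of the n roots of p. *)
Definition integral_divdiff (D : idomainType) (L : closedFieldType)
    (iota : {rmorphism {fraction D} -> L}) (f : {poly {fraction D}})
    (n k : nat) (p : {poly D}) : Prop :=
  forall (beta : n.-tuple L) (i : 'I_k.+1 -> 'I_n),
    roots_with_mult (map_poly (iota \o @tofrac D) p) beta ->
    injective i ->
    integralOver (iota \o @tofrac D)
      (map_mpoly iota (divdiff f k)).@[fun l => tnth beta (i l)].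

(* Main.v *)
Require Import Defs.
From HB Require Import structures.
From mathcomp Require Import all_boot all_algebra all_solvable all_field.
From mathcomp.multinomials Require Import mpoly.
From mathcomp Require Import ring.
From Stdlib Require Import Classical_Prop.
Import GRing.Theory.
Local Open Scope ring_scope.

Set Implicit Arguments.
Unset Strict Implicit.
Unset Printing Implicit Defensive.

Import Pdiv.CommonRing Pdiv.RingMonic.

(** Write K for the fraction field of D, and n for the size of the matrices.
    Everything goes through the remainder of f modulo a monic polynomial p of
    D[X] of degree n.

    Matrices.  Modulo the characteristic polynomial p of M, f and its remainder
    r take the same value at M; so if r is in D[X] then f(M) is integral.
    Conversely the first row of r(C), for C the companion matrix of p, lists the
    coefficients of r.  Hence f is in Int(M_n(D)) if and only if f %% p is in
    D[X] for every such p ([int_valued_mxP]).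

    Divided differences.  Divide f by X - a_0, the quotient by X - a_1, and so
    on: the constants obtained are the coefficients c_j of Newton's expansion
      f = c_0 + c_1 (X - a_0) + c_2 (X - a_0)(X - a_1) + ...
    and c_k is the k-th divided difference of f at a_0, .., a_k.  This makes
    sense over any commutative ring and for repeated points ([divdiffE],
    [divdiff_eval]).  If a_0, .., a_(n-1) are the roots of p, then the first n
    terms of the expansion make up f %% p, so integral divided differences give
    a remainder with coefficients in K and integral over D, i.e. in D.  In the
    other direction, adding to f a multiple of (X - a_0)..(X - a_k), in
    particular a multiple of p, does not change c_k, so f can be replaced with
    its remainder, which is in D[X]; dividing it by the X - a_i keeps the
    coefficients integral ([integral_remP]).

    Irreducible polynomials.  Let d be a nonzero element of D such that d f is
    in D[X].  If p' is congruent to p modulo d and f %% p' is in D[X], then so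
    is f %% p ([integral_rem_congruent]).  Some maximal ideal m of finite index
    does not contain d; as d is invertible modulo m, there is a monic p'
    congruent to p modulo d whose reduction modulo m is any prescribed monic
    polynomial of degree n.  Over the finite field D/m there is an irreducible
    one, and then p' is irreducible too ([irreducible_congruent]). *)

(** * Preliminaries on polynomials *)

Section PolynomialPreliminaries.

Lemma size_map_monic (A B : nzRingType) (phi : {rmorphism A -> B}) (p : {poly A}) :
  p \is monic -> size (map_poly phi p) = size p.
Proof.
by move=> /monicP p1; apply: size_map_poly_id0; rewrite p1 rmorph1 oner_eq0.
Qed.

Lemma lift_poly (A B : nzRingType) (phi : {rmorphism A -> B}) (q : {poly B}) :
  (forall i, exists x, q`_i = phi x) -> exists r : {poly A}, q = map_poly phi r.
Proof.
elim/poly_ind: q => [|q c IHq] im_q; first by exists 0; rewrite rmorph0.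
have [|r ->] := IHq.
  by move=> i; have := im_q i.+1; rewrite coefD coefMX coefC addr0.
have := im_q 0%N; rewrite coefD coefMX coefC add0r => -[x ->].
by exists (r * 'X + x%:P); rewrite rmorphD rmorphM /= map_polyX map_polyC.
Qed.

Lemma horner_mx_modp (F : fieldType) m (A : 'M[F]_m.+1) (f q : {poly F}) :
  horner_mx A q = 0 -> horner_mx A f = horner_mx A (f %% q).
Proof.
by move=> Aq0; rewrite {1}(divp_eq f q) rmorphD rmorphM /= Aq0 mulr0 add0r.
Qed.

End PolynomialPreliminaries.

(** * Iterated division and Newton's expansion *)

Section NewtonQuotients.

Variable R : comNzRingType.
Implicit Types (q g : {poly R}) (a : nat -> R).

Definition linear_quo q (x : R) : {poly R} := rdivp q ('X - x%:P).

Lemma linear_quo_unique q c (x e : R) :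
  q = c * ('X - x%:P) + e%:P -> linear_quo q x = c.
Proof.
move=> ->; apply: rdivp_addl_mul_small; first exact: monicXsubC.
by rewrite size_XsubC ltnS size_polyC leq_b1.
Qed.

Lemma linear_quoP q x : q = linear_quo q x * ('X - x%:P) + q.[x]%:P.
Proof.
have [c /(canRL (subrK _)) e] : exists c, q - q.[x]%:P = c * ('X - x%:P).
  by apply/factor_theorem; rewrite /root !hornerE subrr.
by rewrite (linear_quo_unique e).
Qed.

(** The points form a function on nat rather than a tuple, so that Newton's
    expansion can be built up one point at a time. *)
Fixpoint newton_quo q a k : {poly R} :=
  if k is k'.+1 then linear_quo (newton_quo q a k') (a k') else q.

Definition newton_coef q a k : R := (newton_quo q a k).[a k].

Lemma newton_expansion q a m :
  q = \sum_(j < m) newton_coef q a j *: \prod_(i < j) ('X - (a i)%:P)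
      + newton_quo q a m * \prod_(i < m) ('X - (a i)%:P).
Proof.
elim: m => [|m IHm]; first by rewrite !big_ord0 add0r mulr1.
rewrite {1}IHm big_ord_recr -addrA /=; congr (_ + _).
rewrite big_ord_recr /= -mul_polyC [X in _ = _ + X]mulrA.
rewrite [X in _ = _ + X]mulrAC -mulrDl addrC.
by congr (_ * _); rewrite {1}[LHS](linear_quoP _ (a m)) addrC.
Qed.

Lemma newton_quo_ext q a b k :
  (forall i, (i < k)%N -> a i = b i) -> newton_quo q a k = newton_quo q b k.
Proof.
elim: k => //= k IHk eq_ab; rewrite eq_ab // IHk // => i ik.
by rewrite eq_ab // ltnS ltnW.
Qed.

Lemma newton_coef_ext q a b k :
  (forall i, (i <= k)%N -> a i = b i) -> newton_coef q a k = newton_coef q b k.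
Proof.
move=> eq_ab; rewrite /newton_coef eq_ab //.
by rewrite (@newton_quo_ext q a b) // => i /ltnW; apply: eq_ab.
Qed.

(** Dividing by X - a_0, .., X - a_(k-1) just removes these factors from
    t (X - a_0)..(X - a_(k+m-1)), and division by a monic polynomial is
    additive. *)
Lemma newton_quo_addM q t a k m :
  newton_quo (q + t * \prod_(i < k + m) ('X - (a i)%:P)) a k
    = newton_quo q a k + t * \prod_(i < m) ('X - (a (k + i)%N)%:P).
Proof.
elim: k m => [|k IHk] m /=.
  by congr (_ + _ * _); apply: eq_bigr => i _; rewrite add0n.
rewrite addSnnS IHk big_ord_recl /= addn0.
apply: (@linear_quo_unique _ _ _ (newton_quo q a k).[a k]).
rewrite {1}[newton_quo q a k](linear_quoP _ (a k)) addrAC [in RHS]mulrDl.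
congr (_ + _ + _).
rewrite -mulrA [X in _ = _ * X]mulrC; congr (_ * (_ * _)).
by apply: eq_bigr => i _; rewrite /bump /= addnA addn1 addSn.
Qed.

(** For k + 1 points the added term contributes t (X - a_k) to the last quotient,
    and this vanishes at a_k. *)
Lemma newton_coef_addM q t a k :
  newton_coef (q + t * \prod_(i < k.+1) ('X - (a i)%:P)) a k
    = newton_coef q a k.
Proof.
rewrite /newton_coef -[k.+1]addn1 newton_quo_addM big_ord1 addn0.
by rewrite !hornerE subrr mulr0 addr0.
Qed.

(** The recursion that defines divided differences, with x for the last point:
    both terms on the left are values of the same quotient, at a_k and at x, and
    the next quotient is the difference quotient of that one at a_k. *)
Lemma newton_coefS q a k (x : R) :
  newton_coef q a k - newton_coef q (fun i => if i == k then x else a i) k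
    = newton_coef q (fun i => if i == k.+1 then x else a i) k.+1 * (a k - x).
Proof.
rewrite /newton_coef !eqxx /=.
rewrite !(@newton_quo_ext q (fun i => _) a k) => [|i ik|i ik].
- rewrite {1 2}[newton_quo q a k](linear_quoP _ (a k)) !hornerE subrr mulr0 add0r.
  by rewrite ltn_eqF //; ring.
- by rewrite ltn_eqF // ltnW.
- by rewrite ltn_eqF.
Qed.

End NewtonQuotients.

Section Naturality.

Variables (R S : comNzRingType) (phi : {rmorphism R -> S}).

(** Division by a monic polynomial commutes with ring morphisms.  This reduces
    divided differences at arbitrary, possibly equal, points to the case of
    indeterminates. *)
Lemma newton_quo_map q a k :
  map_poly phi (newton_quo q a k) = newton_quo (map_poly phi q) (phi \o a) k.
Proof.
elim: k => //= k <-; set g := newton_quo q a k.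
set c := linear_quo g (a k).
rewrite (@linear_quo_unique _ _ (map_poly phi c) _ (phi g.[a k])) //.
rewrite {1}[g](linear_quoP _ (a k)) -/c rmorphD rmorphM rmorphB /=.
by rewrite map_polyX !map_polyC.
Qed.

Lemma newton_coef_map q a k :
  phi (newton_coef q a k) = newton_coef (map_poly phi q) (phi \o a) k.
Proof. by rewrite /newton_coef -newton_quo_map horner_map. Qed.

End Naturality.

Section DividedDifferenceValues.

Variable R : comNzRingType.

Lemma omit_var_newton (g : {poly R}) k (v : 'I_k.+2) a j :
  omit_var v (newton_coef (map_poly (@mpolyC k.+1 R) g) a j) =
  newton_coef (map_poly (@mpolyC k.+2 R) g) (omit_var v \o a) j.
Proof.
rewrite /omit_var.
rewrite (newton_coef_map (comp_mpoly [tuple 'X_(lift v i) | i < k.+1])).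
congr newton_coef; rewrite -map_poly_comp; apply: eq_map_poly => c /=.
exact: comp_mpolyC.
Qed.

(** At the generic points, the coefficients of Newton's expansion satisfy the
    recursion that characterizes divided differences. *)
Lemma divdiffE (g : {poly R}) k :
  divdiff g k = newton_coef (map_poly (@mpolyC k.+1 R) g) (fun i => 'X_(inord i)) k.
Proof.
elim: k => [|k IHk].
  by rewrite /newton_coef /=; congr (_.['X_ _]); apply/val_inj; rewrite /= inordK.
apply: (divdiff_step_unique (P := divdiff g k)); apply/eqP; first exact: divdiffS.
rewrite IHk !omit_var_newton.
set G := map_poly _ g; set a := fun i => _ : {mpoly R[k.+2]}.
rewrite (@newton_coef_ext _ G (_ \o _) a k) => [|i ik]; last first.
  rewrite /= omit_varX; congr 'X_ _; apply/val_inj; rewrite /= !inordK ?ltnS //.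
    by rewrite /bump leqNgt ltnS ik.
  exact: leqW.
have -> : newton_coef G (omit_var (penult_ord k) \o (fun i => 'X_(inord i))) k =
    newton_coef G (fun i => if i == k then 'X_ord_max else a i) k.
  apply: newton_coef_ext => i ik /=; rewrite omit_varX.
  have [->|ne] := eqVneq i k; congr 'X_ _; apply/val_inj; rewrite /= !inordK //.
  - by rewrite /bump leqnn.
  - by rewrite /bump leqNgt ltn_neqAle ne ik.
  - by rewrite ltnS leqW.
have -> : 'X_(penult_ord k) = a k.
  by congr 'X_ _; apply/val_inj; rewrite /= inordK // ltnS.
rewrite newton_coefS; congr (_ * _); apply: newton_coef_ext => i ik.
have [->|//] := eqVneq i k.+1; congr 'X_ _; apply/val_inj; rewrite /= inordK //.
Qed.

Lemma divdiff_eval (S : comNzRingType) (phi : {rmorphism R -> S}) g k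
    (v : 'I_k.+1 -> S) :
  (map_mpoly phi (divdiff g k)).@[v]
    = newton_coef (map_poly phi g) (fun i => v (inord i)) k.
Proof.
rewrite divdiffE.
pose ev : {rmorphism _ -> _} := meval v \o map_mpoly phi.
rewrite -[LHS]/(ev _) newton_coef_map -map_poly_comp.
rewrite (@eq_map_poly _ _ _ phi) => [|c /=].
  by apply: newton_coef_ext => i ik; rewrite /= map_mpolyX mevalXU.
by rewrite map_mpolyC ?rmorph0 // mevalC.
Qed.

End DividedDifferenceValues.

(** * Integrality of the remainders *)

Section IntegralNewton.

Variables (R : comNzRingType) (K : fieldType) (phi : {rmorphism R -> K}).
Implicit Types (q : {poly K}) (a : nat -> K).

Let integral_coefs q := forall i, integralOver phi q`_i.

(** Horner's scheme: the coefficients of the quotient c are determined from the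
    top down by c_i = q_(i+1) + x c_(i+1). *)
Lemma integral_linear_quo q x :
  integral_coefs q -> integralOver phi x -> integral_coefs (linear_quo q x).
Proof.
move=> int_q int_x; set c := linear_quo q x.
have c_coef i : c`_i = q`_i.+1 + x * c`_i.+1.
  rewrite [q](linear_quoP _ x) -/c coefD coefC addr0 mulrBr coefB coefMX coefMC /=.
  by ring.
suffices H m i : (size c <= m + i)%N -> integralOver phi c`_i.
  by move=> i; apply: (H (size c)); apply: leq_addr.
elim: m i => [|m IHm] i le_c; first by rewrite nth_default //; apply: integral0.
rewrite c_coef; apply: integral_add; first exact: int_q.
by apply: integral_mul int_x _; apply: IHm; rewrite addnS.
Qed.

Lemma integral_newton_coef q a k :
  integral_coefs q -> (forall i, (i <= k)%N -> integralOver phi (a i)) ->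
  integralOver phi (newton_coef q a k).
Proof.
move=> int_q int_a; apply: integral_horner; last exact: int_a.
apply/integral_poly; elim: k int_a => //= k IHk int_a.
by apply: integral_linear_quo; [apply: IHk => i ik | ]; apply: int_a; rewrite ltnW.
Qed.

Lemma integral_coefs_XsubC_prod a m :
  (forall i, (i < m)%N -> integralOver phi (a i)) ->
  integral_coefs (\prod_(i < m) ('X - (a i)%:P)).
Proof.
elim: m => [|m IHm] int_a i.
  by rewrite big_ord0 coef1; apply: integral_nat.
have int_m j : integralOver phi (\prod_(i < m) ('X - (a i)%:P))`_j.
  by apply: IHm => l lm; apply: int_a; rewrite ltnS ltnW.
rewrite big_ord_recr /= mulrBr coefB coefMX coefMC; apply: integral_sub.
  by case: eqP => _; [apply: integral0 | apply: int_m].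
by apply: integral_mul (int_m _) (int_a _ _).
Qed.

End IntegralNewton.

Section IntegralRemainder.

Variable D : idomainType.
Local Notation K := {fraction D}.
Local Notation toK := (@tofrac D).
Implicit Types (f : {poly K}) (p : {poly D}).

Definition integral_rem f p : Prop :=
  exists r : {poly D}, f %% map_poly toK p = map_poly toK r.

Section Newton.

Variables (L : closedFieldType) (iota : {rmorphism K -> L}).
Hypothesis closedD : integrally_closed D.
Local Notation toL := (iota \o toK).

Lemma integral_descends x : integralOver toL (iota x) -> exists d, x = toK d.
Proof.
case=> p p_monic; rewrite map_poly_comp fmorph_root => px0.
by apply: closedD; exists p.
Qed.

Lemma integral_roots p n (beta : n.-tuple L) : p \is monic ->
  roots_with_mult (map_poly toL p) beta -> forall i, integralOver toL (tnth beta i).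
Proof.
move=> p_monic p_roots i; exists p => //; rewrite p_roots.
rewrite (monicP (monic_map _ p_monic)) scale1r root_prod_XsubC; exact: mem_tnth.
Qed.

Lemma monic_splits p n : p \is monic -> size p = n.+1 ->
  exists beta : n.-tuple L, roots_with_mult (map_poly toL p) beta.
Proof.
move=> p_monic sz_p; have [rs Drs] := closed_field_poly_normal (map_poly toL p).
suffices sz_rs : size rs == n by exists (Tuple sz_rs).
move/(congr1 (size \o polyseq)): Drs.
rewrite /= (monicP (monic_map _ p_monic)) scale1r size_prod_XsubC.
by rewrite size_map_monic // sz_p => -[<-].
Qed.

(** Along all the roots of p, the first n + 1 terms of Newton's expansion of f
    are the remainder of f modulo p, and their coefficients are divided
    differences.  Conversely, the divided differences at some of the roots are
    those of the remainder, because p is a multiple of the linear factors at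
    these roots. *)
Lemma integral_remP f p n : p \is monic -> size p = n.+2 ->
  integral_rem f p <->
    (forall k : nat, (k < n.+1)%N -> integral_divdiff iota f n.+1 k p).
Proof.
move=> p_monic sz_p; set P := map_poly toK p.
have lead1 : lead_coef (map_poly toL p) = 1 by apply/monicP/monic_map.
have sz_P : size (map_poly toL p) = n.+2.
  by rewrite size_map_monic.
split=> [[r Dr] k lt_kn beta i p_roots i_inj | int_dd].
  rewrite divdiff_eval; set a := fun j => _.
  (* The indices i_0, .., i_k are distinct, so p is a multiple of the product of
     the corresponding linear factors. *)
  have split_prod : exists t, map_poly toL p = t * \prod_(j < k.+1) ('X - (a j)%:P).
    rewrite p_roots lead1 scale1r big_tuple.
    exists (\prod_(l | l \notin codom i) ('X - (tnth beta l)%:P)).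
    have uniq_i : uniq (codom i) by rewrite codomE map_inj_uniq ?enum_uniq.
    have -> : \prod_(j < k.+1) ('X - (a j)%:P)
        = \prod_(l <- codom i) ('X - (tnth beta l)%:P).
      rewrite codomE big_map big_enum /=.
      by apply: eq_bigr => j _; rewrite /a inord_val.
    rewrite (big_uniq _ uniq_i) (bigID (fun l => l \notin codom i)) /=.
    by congr (_ * _); apply: eq_bigl => l; rewrite negbK.
  case: split_prod => t Dt.
  have -> : map_poly iota f = map_poly toL r +
     (map_poly iota (f %/ P) * t) * \prod_(j < k.+1) ('X - (a j)%:P).
    rewrite -mulrA -Dt !map_poly_comp -rmorphM -rmorphD /= -/P -Dr addrC.
    by rewrite -divp_eq.
  rewrite newton_coef_addM; apply: integral_newton_coef => [j|j _].
    by rewrite coef_map; apply: integral_id.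
  exact: integral_roots p_roots _.
have [beta p_roots] := monic_splits p_monic sz_p.
pose a (j : nat) := tnth beta (inord j).
have Da : map_poly toL p = \prod_(j < n.+1) ('X - (a j)%:P).
  rewrite p_roots lead1 scale1r big_tuple; apply: eq_bigr => j _.
  by rewrite /a inord_val.
have int_a j : integralOver toL (a j) by apply: integral_roots p_roots _.
(* Modulo p, the term of Newton's expansion with all the linear factors
   vanishes, and the others have degree at most n. *)
have Drem : map_poly iota (f %% P) = \sum_(j < n.+1)
    newton_coef (map_poly iota f) a j *: \prod_(l < j) ('X - (a l)%:P).
  rewrite map_modp -map_poly_comp Da.
  rewrite {1}(newton_expansion (map_poly iota f) a n.+1) addrC.
  rewrite modp_addl_mul_small // -Da sz_P ltnS.
  apply: leq_trans (size_sum _ _ _) _; apply/bigmax_leqP => j _.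
  apply: leq_trans (size_scale_leq _ _) _.
  by rewrite -big_enum size_prod_XsubC size_enum_ord.
apply: lift_poly => i; apply: integral_descends.
rewrite -coef_map Drem coef_sum.
apply: big_ind => [||j _]; [exact: integral0 | exact: integral_add |].
rewrite coefZ; apply: integral_mul; last first.
  by apply: integral_coefs_XsubC_prod => l _.
have widen_inj : injective (widen_ord (ltn_ord j)).
  by move=> l1 l2 /(congr1 val) /= /val_inj.
have := int_dd j (ltn_ord j) beta _ p_roots widen_inj.
rewrite divdiff_eval (@newton_coef_ext _ _ _ a) // => l lj; congr tnth.
by apply/val_inj; rewrite /= !inordK // ltnS (leq_trans lj) // -ltnS.
Qed.

End Newton.
End IntegralRemainder.

(** * Integer-valued polynomials on matrices *)

Section CompanionMatrix.

Variables (R : comNzRingType) (p : {poly R}) (n : nat).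
Hypotheses (p_monic : p \is monic) (sz_p : size p = n.+2).

(** The basis row vectors e_0, .., e_n are e_0 C^0, .., e_0 C^n for the companion
    matrix C: the first row of r(C) is then the list of coefficients of r, when r
    has degree at most n. *)
Lemma companion_first_row : exists C : 'M[R]_n.+1,
  char_poly C = p /\ forall i j : 'I_n.+1, (C ^+ i) 0 j = (i == j)%:R.
Proof.
have e : (size p).-1 = n.+1 by rewrite sz_p.
(* The companion matrix has size (size p).-1, which is n + 1 only up to a
   cast. *)
pose C : 'M[R]_n.+1 := castmx (e, e) (companionmx p); exists C; split.
  rewrite {}/C; move: (n.+1) e => m e; case: _ / e.
  by rewrite castmx_id companionmxK.
have C_row (i j : 'I_n.+1) : (i < n)%N -> C i j = (i.+1 == j :> nat)%:R.
  by move=> lt_in; rewrite castmxE !mxE /= sz_p /= ltn_eqF.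
move=> [i lt_i] j; rewrite -val_eqE /=.
elim: i lt_i j => [|i IHi] lt_i j; first by rewrite expr0 mxE.
rewrite exprSr !mxE (bigD1 (Ordinal (ltnW lt_i))) //= (IHi (ltnW lt_i)) eqxx mul1r.
rewrite C_row //= big1 ?addr0 // => l ne_l.
rewrite (IHi (ltnW lt_i)) eq_sym -[i]/(val (Ordinal (ltnW lt_i))) val_eqE.
by rewrite (negPf ne_l) mul0r.
Qed.

End CompanionMatrix.

Section IntegerValued.

Variable D : idomainType.
Local Notation K := {fraction D}.
Local Notation toK := (@tofrac D).

(** By Cayley-Hamilton, f(M) only depends on the remainder of f modulo the
    characteristic polynomial of M, and every monic p is the characteristic
    polynomial of its companion matrix. *)
Lemma int_valued_mxP n (f : {poly K}) :
  int_valued_mx n f <->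
    forall p : {poly D}, p \is monic -> size p = n.+2 -> integral_rem f p.
Proof.
have root_char (M : 'M[D]_n.+1) :
    horner_mx (map_mx toK M) (map_poly toK (char_poly M)) = 0.
  by rewrite map_char_poly; exact: Cayley_Hamilton.
split=> [f_int p p_monic sz_p | rem_f M].
  have [C [Dp Crow]] := companion_first_row p_monic sz_p.
  have [N] := f_int C.
  rewrite (horner_mx_modp _ (root_char C)) Dp; set r := f %% _ => /matrixP CN.
  have sz_r : (size r <= n.+1)%N.
    rewrite -ltnS -sz_p -(size_map_monic toK p_monic) ltn_modp.
    by rewrite monic_neq0 ?monic_map.
  apply: lift_poly => i; have [le_ni|lt_in] := leqP n.+1 i.
    by exists 0; rewrite rmorph0 nth_default // (leq_trans sz_r).
  exists (N 0 (Ordinal lt_in)); have := CN 0 (Ordinal lt_in).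
  rewrite [map_mx toK N _ _]mxE => CNi; apply: etrans CNi.
  rewrite -/r -[in RHS](take_poly_id sz_r) /take_poly poly_def.
  rewrite rmorph_sum /= summxE (bigD1 (Ordinal lt_in)) //= big1 => [|l ne_l].
    rewrite linearZ rmorphXn /= horner_mx_X -(rmorphXn (map_mx toK)) !mxE.
    by rewrite (Crow (Ordinal lt_in)) eqxx rmorph1 mulr1 addr0.
  rewrite linearZ rmorphXn /= horner_mx_X -(rmorphXn (map_mx toK)) !mxE.
  by rewrite Crow (negPf ne_l) rmorph0 mulr0.
have [r Dr] := rem_f _ (char_poly_monic M) (size_char_poly M).
exists (horner_mx M r); rewrite (horner_mx_modp _ (root_char M)) Dr.
by rewrite map_horner_mx.
Qed.
End IntegerValued.

(** * Irreducible polynomials over finite fields *)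

Section FiniteFieldIrreducible.

(** With q the number of elements of F and N = q^(n+1) - 1, adjoin to F a
    primitive N-th root of unity w.  The field F(w) has q^d elements for some d,
    so N divides q^d - 1 and d > n.  Conversely w is fixed by the (n+1)-st power of
    the Frobenius x |-> x^q, hence so is F(w): all its elements are roots of
    X^(q^(n+1)) - X, and d <= n + 1.  The minimal polynomial of w is the one
    sought. *)
Lemma finField_irreducible (F : finFieldType) n :
  exists2 g : {poly F}, g \is monic & size g = n.+2 /\ irreducible_poly g.
Proof.
set q := #|F|; have q_gt1 : (1 < q)%N by exact: finNzRing_gt1.
pose N := (q ^ n.+1).-1.
have qn_gt1 : (1 < q ^ n.+1)%N by rewrite -(exp1n n.+1) ltn_exp2r.
have NS : N.+1 = (q ^ n.+1)%N by rewrite prednK // ltnW.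
have N_gt0 : (0 < N)%N by rewrite -ltnS NS.
have /FinSplittingFieldFor[L [zs Dzs _]] : 'X^N - 1 != 0 :> {poly F}.
  by rewrite monic_neq0 // monicXnsubC.
rewrite rmorphB rmorphXn /= map_polyX rmorph1 in Dzs.
(* As N + 1 = 0 in L, X^N - 1 is separable. *)
have N_neq0 : N%:R != 0 :> L.
  have q0 : q%:R = 0 :> L.
    have [p _ pcharF] := finPcharP F.
    have Dq : q = (p ^ logn p q)%N := card_pprimeChar pcharF.
    move: q_gt1; rewrite Dq; case: (logn _ _) => // m _.
    by rewrite -(pchar_lalg L) in pcharF; rewrite expnS natrM (pcharf0 pcharF) mul0r.
  apply: contraTneq isT => N0; have := natrX L q n.+1.
  by rewrite -NS q0 expr0n -natr1 N0 add0r => /eqP; rewrite oner_eq0.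
have zs_uniq : uniq zs.
  rewrite -separable_prod_XsubC -(eqp_separable Dzs).
  by rewrite cyclotomic.separable_Xn_sub_1.
have sz_zs : size zs = N.
  by apply: succn_inj; rewrite -(size_prod_XsubC _ id) -(eqp_size Dzs) size_XnsubC.
have /hasP[w _ w_prim] : has N.-primitive_root zs.
  apply: has_prim_root => //; last by rewrite sz_zs.
  apply/allP => z; rewrite unity_rootE -root_prod_XsubC -(eqp_root Dzs).
  by rewrite /root !hornerE subr_eq0.
pose E := <<1; w>>%AS.
have wN1 : w ^+ N = 1 := prim_expr_order w_prim.
have le_nd : (n < \dim E)%N.
  have : w \in E by rewrite memv_adjoin.
  rewrite Fermat's_little_theorem => /eqP w_fix.
  have qd_gt0 : (0 < q ^ \dim E)%N by rewrite expn_gt0 ltnW.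
  have w_unit : w ^+ (q ^ \dim E).-1 == 1.
    have w_neq0 : w != 0 by rewrite (prim_root_eq0 w_prim) -lt0n.
    by apply/eqP/(mulfI w_neq0); rewrite mulr1 -exprS prednK.
  rewrite -(leq_exp2l _ _ q_gt1) -NS -(prednK qd_gt0) ltnS.
  apply: dvdn_leq; last by rewrite (prim_order_dvd w_prim).
  rewrite -ltnS prednK // (leq_trans q_gt1) //.
  by rewrite -[X in (X <= _)%N]expn1 leq_exp2l // adim_gt0.
have [a _ Da] := finField_galois_generator (sub1v {:L}).
have {}Da k x : (a ^+ k)%g x = x ^+ (q ^ k).
  elim: k => [|k IHk]; first by rewrite gal_id.
  by rewrite expgSr galM ?memvf // IHk Da ?memvf // dimv1 expn1 expnSr exprM.
have le_dn : (\dim E <= n.+1)%N.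
  have E_fix : (E <= fixedSpace (a ^+ n.+1)%g)%VS.
    by rewrite sub_adjoin1v; apply/fixedSpaceP; rewrite Da -NS exprS wN1 mulr1.
  pose finL := FinFieldExtType L.
  rewrite -(leq_exp2l _ _ q_gt1) -(card_vspace (T := finL)).
  rewrite cardE -ltnS.
  have sz_XqX : size ('X^(q ^ n.+1) - 'X : {poly finL}) = (q ^ n.+1).+1.
    by rewrite size_polyDl size_polyXn // size_polyN size_polyX.
  rewrite -sz_XqX; apply: max_poly_roots; last exact: enum_uniq.
    by rewrite -size_poly_eq0 sz_XqX.
  apply/allP => x; rewrite mem_enum => /(subvP E_fix)/fixedSpaceP.
  by rewrite Da rootE !hornerE subr_eq0 => /eqP.
have d_n : adjoin_degree 1 w = n.+1.
  have := dim_Fadjoin 1 w; rewrite dimv1 muln1 => <-.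
  by apply/eqP; rewrite eqn_leq le_dn le_nd.
have /polyOver1P[g Dg] := minPolyOver 1 w.
exists g; first by rewrite -(map_monic (in_alg L)) -Dg monic_minPoly.
split; first by rewrite -(size_map_poly (in_alg L)) -Dg size_minPoly d_n.
split; first by rewrite -(size_map_poly (in_alg L)) -Dg size_minPoly d_n.
move=> h h_neq1 h_dvd; set H := map_poly (in_alg L) h.
have H1 : H \is a polyOver 1%VS by apply/polyOver1P; exists h.
have H_dvd : H %| minPoly 1 w by rewrite Dg dvdp_map.
have := minPoly_irr H1 H_dvd.
by rewrite Dg eqp_map -size_poly_eq1 size_map_poly (negPf h_neq1) orbF.
Qed.
End FiniteFieldIrreducible.

(** * Residue fields of finite index *)

Section ResidueFields.

Local Open Scope quotient_scope.

(** The quotient by a maximal ideal of finite index is a finite field only by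
    virtue of a proof, so the hypotheses are the bare facts, and irreducibility
    is expressed in the ring structure of Q. *)
Lemma finite_field_irreducible (Q : comNzRingType) (s : seq Q) n :
  (forall x, x \in s) -> (forall x : Q, x != 0 -> exists y, y * x == 1) ->
  exists2 g : {poly Q}, g \is monic /\ size g = n.+2 &
    forall a b, g = a * b -> size a = 1%N \/ size b = 1%N.
Proof.
move=> s_all Q_inv.
(* The search fails for x = 0 and then returns the default value 0, as inv0
   requires. *)
pose inv (x : Q) : Q := nth 0 s (find (fun y => y * x == 1) s).
have mulVx (x : Q) : x != 0 -> inv x * x = 1.
  case/Q_inv=> y yx1; apply/eqP/(@nth_find _ 0 (fun y => y * x == 1)).
  by apply/hasP; exists y.
have inv0 : inv 0 = 0.
  rewrite /inv nth_default // leqNgt -has_find; apply/hasPn => y _.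
  by rewrite mulr0 eq_sym oner_eq0.
have indexK : pcancel (index^~ s)
    (fun i => if (i < size s)%N then Some (nth 0 s i) else None).
  by move=> x; rewrite index_mem s_all nth_index.
have enumP : Finite.axiom (undup s).
  by apply: Finite.uniq_enumP (undup_uniq s) _ => x; rewrite mem_undup s_all.
pose F : finFieldType := HB.pack Q (PCanIsCountable indexK) (isFinite.Build Q enumP)
  (GRing.ComNzRing_isField.Build Q mulVx inv0).
have [g g_monic [sz_g g_irr]] := finField_irreducible F n.
exists g => // a b Dg.
have [|b_neq1] := eqVneq (size b) 1%N; [by right | left].
have /eqp_size sz_b : (b : {poly F}) %= g by apply: g_irr; rewrite // Dg dvdp_mull.
have g_neq0 : g != 0 by rewrite monic_neq0.
have : a * b != 0 :> {poly F} by rewrite -Dg.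
rewrite mulf_eq0 => /norP[a_neq0 b_neq0].
have := size_mul (a_neq0 : a != 0 :> {poly F}) b_neq0; rewrite -Dg -sz_b.
rewrite -(prednK (_ : (0 < size b)%N)) ?size_poly_gt0 // addnS /=.
by rewrite -[LHS]add1n => /addIn <-.
Qed.

Variables (D : comNzRingType) (m : idealr D).
Local Notation Q := {ideal_quot m}.
Hypotheses (m_max : maximal_ideal m).
Variable (s : seq Q).
Hypothesis s_all : forall x, x \in s.

(** The ideal m + D x.  An ideal is a boolean predicate, so membership is decided
    by trying the finitely many classes modulo m as coefficients of x. *)
Definition ideal_adjoin (x : D) : pred D :=
  fun z => has (fun u : Q => \pi_Q z == u * \pi_Q x) s.

Lemma ideal_adjoinP x z :
  reflect (exists y, \pi_Q z = \pi_Q (y * x)) (z \in ideal_adjoin x).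
Proof.
apply: (iffP hasP) => [[u _ /eqP ->]|[y ->]].
  by exists (repr u); rewrite rmorphM /= reprK.
by exists (\pi_Q y); rewrite // rmorphM.
Qed.

(** If 1 were not in m + D x, this would be a proper ideal containing m, hence
    contained in m, and x would be in m. *)
Lemma maximal_ideal_inv x : x \notin m -> exists y, y * x - 1 \in m.
Proof.
move=> x_notin; suff /ideal_adjoinP[y e] : 1 \in ideal_adjoin x.
  by exists y; rewrite Quotient.idealrBE -e.
apply: contraNT x_notin => J1.
have J_closed : idealr_closed (ideal_adjoin x).
  split=> //.
    by apply/ideal_adjoinP; exists 0; rewrite mul0r.
  move=> a u v /ideal_adjoinP[y uy] /ideal_adjoinP[z vz]; apply/ideal_adjoinP.
  by exists (a * y + z); rewrite mulrDl -mulrA !rmorphD !rmorphM /= uy vz !rmorphM.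
pose J : idealr D := HB.pack (ideal_adjoin x) (isIdealr.Build D _ J_closed).
apply: (m_max (J := J)).
  move=> z z_m; apply/ideal_adjoinP; exists 0; apply/eqP.
  by rewrite mul0r -Quotient.idealrBE subr0.
by apply/ideal_adjoinP; exists 1; rewrite mul1r.
Qed.

End ResidueFields.

(** * Reduction to irreducible polynomials *)

Section IrreducibleReduction.

Variable D : idomainType.
Local Notation K := {fraction D}.
Local Notation toK := (@tofrac D).

(** In a factorization of a monic polynomial the leading coefficients are units,
    so they survive reduction: a factor that becomes constant already was, and it
    is its own, invertible, leading coefficient. *)
Lemma monic_reduction_irreducible (Q : comNzRingType)
    (phi : {rmorphism D -> Q}) n (p : {poly D}) :
  p \is monic -> size p = n.+2 ->
  (forall a b, map_poly phi p = a * b -> size a = 1%N \/ size b = 1%N) ->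
  irreducible_elt p.
Proof.
move=> p_monic sz_p irr_p; split; first exact: monic_neq0.
  by rewrite poly_unitE sz_p.
move=> y z Dp.
have lead_yz : lead_coef y * lead_coef z = 1.
  by rewrite -lead_coefM -Dp (monicP p_monic).
have unit_of (u v : {poly D}) : lead_coef u * lead_coef v = 1 ->
    size (map_poly phi u) = 1%N -> u \is a GRing.unit.
  move=> lead_uv; rewrite size_map_poly_id0 => [sz_u|].
    have Du : lead_coef u = u`_0 by rewrite lead_coefE sz_u.
    rewrite poly_unitE; apply/andP; split; first exact/eqP.
    by apply/unitrPr; exists (lead_coef v); rewrite -Du.
  apply/eqP => phi0; have := congr1 phi lead_uv.
  by rewrite rmorphM phi0 mul0r rmorph1 => /esym/eqP; rewrite oner_eq0.
have Dphi : map_poly phi p = map_poly phi y * map_poly phi z.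
  by rewrite Dp rmorphM.
have [sz1|sz1] := irr_p _ _ Dphi.
  by left; apply: unit_of lead_yz sz1.
by right; apply: unit_of sz1; rewrite mulrC; exact: lead_yz.
Qed.

(** Chinese remaindering of monic polynomials: the result is p modulo d and g
    modulo the kernel of phi. *)
Lemma monic_lift_congruent (Q : comNzRingType) (phi : {rmorphism D -> Q}) rho
    (d e : D) n (p : {poly D}) (g : {poly Q}) :
  cancel rho phi -> phi (d * e) = 1 ->
  p \is monic -> size p = n.+2 -> g \is monic -> size g = n.+2 ->
  exists2 h : {poly D}, (size (d *: h) < size p)%N & map_poly phi (p + d *: h) = g.
Proof.
move=> rhoK de1 p_monic sz_p g_monic sz_g.
(* Stopping at degree n leaves the leading term of p untouched. *)
exists (e *: \poly_(i < n.+1) (rho g`_i - p`_i)).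
  rewrite sz_p ltnS; apply: leq_trans (size_scale_leq _ _) _.
  by apply: leq_trans (size_scale_leq _ _) _; apply: size_poly.
apply/polyP => i; rewrite coef_map !coefD !coefZ coef_poly mulrA /=.
rewrite rmorphD rmorphM de1 mul1r.
have [_|] := ltnP i n.+1.
  by rewrite rmorphB /= rhoK addrC subrK.
rewrite rmorph0 addr0 leq_eqVlt => /orP[/eqP <-|lt_ni].
  have -> : p`_n.+1 = 1 by rewrite -(monicP p_monic) lead_coefE sz_p.
  by rewrite rmorph1 -(monicP g_monic) lead_coefE sz_g.
by rewrite !nth_default ?sz_p ?sz_g // rmorph0.
Qed.

Local Open Scope quotient_scope.

Lemma irreducible_congruent (m : idealr D) (d : D) n (p : {poly D}) :
  maximal_ideal m -> finite_index m -> d \notin m ->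
  p \is monic -> size p = n.+2 ->
  exists h, let p' := p + d *: h in
    [/\ p' \is monic, size p' = n.+2 & irreducible_elt p'].
Proof.
move=> m_max [s s_all] d_notin p_monic sz_p.
pose pi : {rmorphism D -> {ideal_quot m}} := \pi_{ideal_quot m}.
have pi_eq0 x : (pi x == 0) = (x \in m).
  by rewrite -(rmorph0 pi) -Quotient.idealrBE subr0.
have Q_inv (x : {ideal_quot m}) : x != 0 -> exists y, y * x == 1.
  rewrite -[x]reprK pi_eq0 => /(maximal_ideal_inv m_max s_all)[y yx].
  by exists (pi y); rewrite -rmorphM -(rmorph1 pi) -Quotient.idealrBE.
have [g [g_monic sz_g] g_irr] := finite_field_irreducible n s_all Q_inv.
have [e /=] := maximal_ideal_inv m_max s_all d_notin.
rewrite mulrC -pi_eq0 rmorphB rmorph1 subr_eq0 => /eqP de1.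
have reprpi : cancel repr pi := @reprK _ _.
have [h sz_dh Dg] := monic_lift_congruent reprpi de1 p_monic sz_p g_monic sz_g.
have sz_p' : size (p + d *: h) = n.+2 by rewrite size_polyDl.
have p'_monic : p + d *: h \is monic.
  by rewrite monicE lead_coefDl // (monicP p_monic).
exists h; split=> //; apply: (@monic_reduction_irreducible _ pi n) => //.
by rewrite Dg.
Qed.

Lemma tofrac_inj : injective toK.
Proof. by move=> x y /eqP; rewrite tofrac_eq => /eqP. Qed.

Lemma common_denominator (f : {poly K}) :
  exists2 d, d != 0 & exists F, toK d *: f = map_poly toK F.
Proof.
have den x : exists2 d, d != 0 & exists c, toK d * x = toK c.
  elim/quotW: x => x; exists \d_x; first exact: denom_ratioP.
  exists \n_x; rewrite /tofrac; unlock FracField.tofrac.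
  rewrite -[LHS]FracField.pi_mul; apply/eqmodP.
  rewrite /= FracField.equivfE /FracField.mulf !numden_Ratio //;
    rewrite ?mulf_neq0 ?denom_ratioP ?oner_eq0 //.
  by apply/eqP; ring.
elim/poly_ind: f => [|f c [d d_neq0 [F DF]]].
  by exists 1; [exact: oner_neq0 | exists 0; rewrite rmorph0 scaler0].
have [e e_neq0 [b Db]] := den c; exists (d * e); first by rewrite mulf_neq0.
exists (e *: F * 'X + (d * b)%:P).
have -> : map_poly toK (e *: F * 'X + (d * b)%:P)
    = toK e *: map_poly toK F * 'X + (toK d * toK b)%:P.
  by rewrite rmorphD rmorphM /= map_polyX map_polyC map_polyZ /= rmorphM.
by rewrite -DF -Db rmorphM /= -!mul_polyC !polyCM; ring.
Qed.

(** Divide d f by p' = p + d h in D[X].  The remainder is d r, with r in D[X] the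
    remainder of f modulo p', so d f = Q p' + d r = Q p + d (Q h + r), and f is
    congruent modulo p to Q h + r, which is in D[X]. *)
Lemma integral_rem_congruent (f : {poly K}) d F (p h : {poly D}) :
  d != 0 -> toK d *: f = map_poly toK F ->
  p \is monic -> p + d *: h \is monic ->
  integral_rem f (p + d *: h) -> integral_rem f p.
Proof.
move=> d_neq0 DF p_monic p'_monic [r Dr].
set p' := p + d *: h in p'_monic Dr.
pose Q := rdivp F p'; pose s := Q * h + r.
exists (rmodp s p).
have d_neq0K : toK d != 0 by rewrite tofrac_eq0.
have DF' : F = Q * p + d *: s.
  have sz_rem : (size (map_poly toK (rmodp F p')) < size (map_poly toK p'))%N.
    rewrite (size_map_monic _ p'_monic); apply: leq_ltn_trans (size_poly _ _) _.
    exact: ltn_rmodpN0 (monic_neq0 p'_monic).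
  have DK : map_poly toK F
      = map_poly toK Q * map_poly toK p' + map_poly toK (rmodp F p').
    by rewrite -rmorphM -rmorphD -rdivp_eq.
  have Drem : rmodp F p' = d *: r.
    apply: (map_inj_poly tofrac_inj (rmorph0 _)).
    by rewrite (modpP DK sz_rem) -DF modpZl Dr -map_polyZ.
  by rewrite {1}(rdivp_eq p'_monic F) Drem /s /p' -/Q -!mul_polyC; ring.
have Df : f =
    ((toK d)^-1 *: map_poly toK Q + map_poly toK (rdivp s p)) * map_poly toK p
      + map_poly toK (rmodp s p).
  apply: (scalerI d_neq0K); rewrite DF DF' {1}(rdivp_eq p_monic s).
  rewrite rmorphD rmorphM /= map_polyZ rmorphD rmorphM /=.
  rewrite [RHS]scalerDr scalerAl [in RHS]scalerDr scalerA mulfV // scale1r.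
  by rewrite -!mul_polyC; ring.
apply/esym/(modpP Df); rewrite (size_map_monic _ p_monic).
apply: leq_ltn_trans (size_poly _ _) _; exact: ltn_rmodpN0 (monic_neq0 p_monic).
Qed.

End IrreducibleReduction.

(** * Characterization of Int(M_n(D)) *)

Theorem theorem4p1 (D : idomainType) (hD : integrally_closed D)
    (L : closedFieldType) (iota : {rmorphism {fraction D} -> L})
    (hL : algebraic_closure iota) (f : {poly {fraction D}}) (n : nat) :
  (int_valued_mx n f <->
     forall k : nat, (k < n.+1)%N ->
     forall p : {poly D}, p \is monic -> size p = n.+2 ->
       integral_divdiff iota f n.+1 k p)
  /\
  ((forall d : D,
      (forall m : idealr D, maximal_ideal m -> finite_index m -> d \in m) ->
      d = 0) ->
   (int_valued_mx n f <->
      forall k : nat, (k < n.+1)%N ->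
      forall p : {poly D}, p \is monic -> size p = n.+2 -> irreducible_elt p ->
        integral_divdiff iota f n.+1 k p)).
Proof.
have rem_dd p (p_monic : p \is monic) (sz_p : size p = n.+2) :=
  integral_remP iota hD f p_monic sz_p.
split.
  rewrite int_valued_mxP.
  split=> [rem_f k lt_kn p p_monic sz_p | dd_f p p_monic sz_p].
    have := rem_f p p_monic sz_p; rewrite rem_dd //; exact.
  by apply/rem_dd => // k lt_kn; apply: dd_f.
move=> cap0; rewrite int_valued_mxP.
split=> [rem_f k lt_kn p p_monic sz_p _ | dd_f p p_monic sz_p].
  have := rem_f p p_monic sz_p; rewrite rem_dd //; exact.
have [d d_neq0 [F DF]] := common_denominator f.
have [m [m_max m_fin d_notin]] :
    exists m : idealr D, [/\ maximal_ideal m, finite_index m & d \notin m].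
  (* Otherwise every such ideal contains d, which is then 0. *)
  apply: NNPP => no_m; case/eqP: d_neq0; apply: cap0 => m m_max m_fin.
  by apply/negPn/negP => d_notin; case: no_m; exists m.
have [h [p'_monic sz_p' p'_irr]] :=
  irreducible_congruent m_max m_fin d_notin p_monic sz_p.
apply: (integral_rem_congruent d_neq0 DF p_monic p'_monic).
by apply/rem_dd => // k lt_kn; apply: dd_f.
Qed.
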